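(* Let $\mathcal{X}$ be a covariate space, $\mathbb{P}^X$ a distribution on $\mathcal{X}$, $A\ge0$, $\sigma>0$, and $\mathcal{C}$ a class of functions $\mathcal{X}\to\mathbb{R}$. Under the model below, $$\mathfrak{M}_n^{\mathrm{EB}}(\mathcal{C};A,\sigma^2)\ \le\ \frac{\sigma^4}{(\sigma^2+A)^2}\,\mathfrak{M}_n^{\mathrm{Reg}}(\mathcal{C};A+\sigma^2).$$
   Context: Model: for a function $m:\mathcal{X}\to\mathbb{R}$, data are i.i.d. triples with $X_i\sim\mathbb{P}^X$, $\mu_i\mid X_i\sim N(m(X_i),A)$, $Z_i\mid \mu_i\sim N(\mu_i,\sigma^2)$; only $(X_i,Z_i)$, $i=1,\dots,n$, are observed, $\sigma^2$ known. The Bayes rule is $t^*_{m,A}(x,z)=\frac{A}{\sigma^2+A}z+\frac{\sigma^2}{\sigma^2+A}m(x)$. For a denoiser $t:\mathcal{X}\times\mathbb{R}\to\mathbb{R}$, $L(t;m,A)=\mathbb{E}_{m,A}[(t(X_{n+1},Z_{n+1})-\mu_{n+1})^2]-\mathbb{E}_{m,A}[(t^*_{m,A}(X_{n+1},Z_{n+1})-\mu_{n+1})^2]$ with $(X_{n+1},\mu_{n+1},Z_{n+1})$ a fresh independent draw. $\mathfrak{M}_n^{\mathrm{EB}}(\mathcal{C};A,\sigma^2)=\inf_{\hat t_n}\sup_{m\in\mathcal{C}}\mathbb{E}_{m,A}[L(\hat t_n;m,A)]$, infimum over denoisers measurable with respect to $(X_i,Z_i)_{1\le i\le n}$. $\mathfrak{M}_n^{\mathrm{Reg}}(\mathcal{C};A+\sigma^2)=\inf_{\hat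 m_n}\sup_{m\in\mathcal{C}}\mathbb{E}_{m,A}\big[\int(\hat m_n(x)-m(x))^2d\mathbb{P}^X(x)\big]$, infimum over estimators $\hat m_n$ measurable with respect to $(X_i,Z_i)_{1\le i\le n}$ (note $Z_i\mid X_i\sim N(m(X_i),A+\sigma^2)$). *)

(* Defs.v *)
From HB Require Import structures.
From mathcomp Require Import all_boot all_order all_algebra.
From mathcomp Require Import all_classical all_reals all_analysis.
Set Implicit Arguments. Unset Strict Implicit. Unset Printing Implicit Defensive.
Import Order.TTheory GRing.Theory Num.Theory.
Local Open Scope classical_set_scope.
Local Open Scope ring_scope.

Section EB.
Context {R : realType}.

(* Gaussian law N(c, v) with variance v >= 0; for v = 0 the Dirac mass at c
   (the library's normal_prob is parametrised by the standard deviation and is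
   not the Dirac mass for a zero standard deviation). *)
Definition gauss (c v : R) : set R -> \bar R :=
  if v == 0 then \d_c else normal_prob c (Num.sqrt v).

Context {d : measure_display} {T : measurableType d}.

(* Expectation of f(X, mu, Z) under the model:
   X ~ PX, mu | X ~ N(m X, A), Z | mu ~ N(mu, s2). *)
Definition E3 (PX : probability T R) (m : T -> R) (A s2 : R)
  (f : T -> R -> R -> \bar R) : \bar R :=
  (\int[PX]_x \int[gauss (m x) A]_mu \int[gauss mu s2]_z f x mu z)%E.

(* Expectation of a function of n i.i.d. observed pairs (X_i, Z_i),
   as an iterated integral over the n independent draws. *)
Fixpoint Edata (PX : probability T R) (m : T -> R) (A s2 : R) (n : nat) :
  (n.-tuple (T * R) -> \bar R) -> \bar R :=
  match n with
  | 0 => fun F => F [tuple]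
  | k.+1 => fun F =>
      E3 PX m A s2 (fun x _ z =>
        Edata PX m A s2 (fun s : k.-tuple (T * R) => F (cons_tuple (x, z) s)))
  end.

Definition bayes_rule (m : T -> R) (A s2 : R) (x : T) (z : R) : R :=
  A / (s2 + A) * z + s2 / (s2 + A) * m x.

Definition EB_loss (PX : probability T R) (m : T -> R) (A s2 : R)
  (t : T -> R -> R) : \bar R :=
  (E3 PX m A s2 (fun x mu z => ((t x z - mu) ^+ 2)%:E)
   - E3 PX m A s2 (fun x mu z => ((bayes_rule m A s2 x z - mu) ^+ 2)%:E))%E.

Definition minimax_EB (PX : probability T R) (C : set (T -> R)) (A s2 : R)
  (n : nat) : \bar R :=
  ereal_inf [set ereal_sup [set Edata PX m A s2 (fun D => EB_loss PX m A s2 (th D))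
                           | m in C]
            | th in [set th : n.-tuple (T * R) -> T -> R -> R |
                measurable_fun setT
                  (fun p : n.-tuple (T * R) * (T * R) => th p.1 p.2.1 p.2.2)]].

(* Regression minimax risk, data generated from the same model
   (so Z_i | X_i ~ N(m(X_i), A + s2)). *)
Definition minimax_Reg (PX : probability T R) (C : set (T -> R)) (A s2 : R)
  (n : nat) : \bar R :=
  ereal_inf [set ereal_sup [set Edata PX m A s2
                               (fun D => \int[PX]_x ((mh D x - m x) ^+ 2)%:E)%E
                           | m in C]
            | mh in [set mh : n.-tuple (T * R) -> T -> R |
                measurable_fun setT
                  (fun p : n.-tuple (T * R) * T => mh p.1 p.2)]].

End EB.

(* Main.v *)
Require Import Defs.
From HB Require Import structures.
From mathcomp Require Import all_boot all_order all_algebra.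
From mathcomp Require Import all_classical all_reals all_analysis.
From mathcomp Require Import measurable_realfun ftc ring lra.
Import Order.TTheory GRing.Theory Num.Theory.
Import numFieldNormedType.Exports.
Local Open Scope classical_set_scope.
Local Open Scope ring_scope.

(* Given a regression estimator [mh], plug it into the Bayes rule in place of
   [m].  Integrating the quadratic [(a z + (1 - a) h - u)^2], with
   [a = A / (s2 + A)], first against N(u, s2) in [z] and then against N(m, A) in
   [u] gives [A s2 / (s2 + A) + (1 - a)^2 (h - m)^2]; the first term is the Bayes
   risk, so the excess loss of the plug-in denoiser is exactly
   [(1 - a)^2 = s2^2 / (s2 + A)^2] times the regression loss of [mh]. *)

(** * Scaling a nonnegative integral by a positive constant *)

Section integral_scaling.
Local Open Scope ereal_scope.
Import HBNNSimple.
Context (d : measure_display) (T : measurableType d) (R : realType).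
Variable mu : {measure set T -> \bar R}.

(** If a simple function [h] lies below [f], then [k * h] is simple and lies below [k * f], so it
    competes in the supremum on the right. *)
Let ge0_integral_pZl_le (f : T -> \bar R) (k : R) : (0 < k)%R ->
  (forall x, 0 <= f x) -> k%:E * \int[mu]_x f x <= \int[mu]_x (k%:E * f x).
Proof.
move=> k0 f0.
have kf0 x : 0 <= k%:E * f x by rewrite mule_ge0// lee_fin ltW.
rewrite !ge0_integralTE// -ereal_sup_pZl//.
apply: ge_ereal_sup => _ [_ [h /= hf <-] <-].
apply: le_ereal_sup_tmp; exists (k%:E * sintegral mu h) => //.
exists (scale_nnsfun h (ltW k0)) => /=.
  by move=> x; rewrite EFinM lee_pmul2l// ?lte_fin.
by rewrite -sintegralrM.
Qed.

(* For arbitrary, possibly non-measurable [f], by working on the simple functions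
   below [f]; the iterated integrals of [Edata] are then never to be shown
   measurable. *)
Lemma ge0_integral_pZl (f : T -> \bar R) (k : R) : (0 < k)%R ->
  (forall x, 0 <= f x) -> \int[mu]_x (k%:E * f x) = k%:E * \int[mu]_x f x.
Proof.
move=> k0 f0; apply/eqP; rewrite eq_le ge0_integral_pZl_le// andbT.
have kf0 x : 0 <= k%:E * f x by rewrite mule_ge0// lee_fin ltW.
have kV0 : (0 < k^-1)%R by rewrite invr_gt0.
(* The reverse inequality is the first one applied to [k^-1] and [k * f]. *)
have := @ge0_integral_pZl_le _ _ kV0 kf0.
rewrite -lee_pdivrMl// => /le_trans; apply.
rewrite le_eqVlt; apply/orP; left; apply/eqP; apply: eq_integral => x _.
by rewrite muleA -EFinM mulVf ?gt_eqF// mul1e.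
Qed.

End integral_scaling.

(** * Second moment of an affine function under a normal law *)

Section normal_second_moment.
Context {R : realType}.
Variables m s : R.
Local Notation mu := lebesgue_measure.

(** The Radon-Nikodym derivative and [normal_pdf] have the same integral over every measurable
    subset of [U], hence agree almost everywhere there. *)
Lemma integral_normal_prob (f : R -> \bar R) (U : set R) : measurable U ->
  (normal_prob m s).-integrable U f ->
  (\int[normal_prob m s]_(x in U) f x =
   \int[mu]_(x in U) (f x * (normal_pdf m s x)%:E))%E.
Proof.
move=> mU intf; have mf := measurable_int _ intf.
have dom := normal_prob_dominates m s.
rewrite -(Radon_Nikodym_change_of_variables dom)//=.
apply: ae_eq_integral => //.
- apply: emeasurable_funM => //; apply: (measurable_int mu).
  apply: (integrableS _ _ (@subsetT _ _)) => //=.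
  exact: Radon_Nikodym_integrable.
- apply: emeasurable_funM => //=; apply/measurable_EFinP/measurable_funTS.
  exact: measurable_normal_pdf.
- apply: ae_eqe_mul2l => /=.
  rewrite Radon_NikodymE//=.
  case: cid => /= h [h1 h2 h3].
  apply: integral_ae_eq => //=.
  + exact: integrableS h2.
  + by apply/measurable_EFinP/measurable_funTS; exact: measurable_normal_pdf.
  + by move=> E E01 mE; rewrite -h3.
Qed.

Lemma is_derive_normal_pdf (x : R) : s != 0 ->
  is_derive x 1 (normal_pdf m s) (- (x - m) / s ^+ 2 * normal_pdf m s x).
Proof.
move=> s0; rewrite normal_pdfE//.
pose e (y : R) : R := - (y - m) ^+ 2 / (s ^+ 2 *+ 2).
have de : is_derive x 1 e (- (x - m) / s ^+ 2).
  by rewrite /e; apply: is_derive_eq; rewrite /GRing.scale/=; field.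
have dexp : is_derive x 1 (expR \o e) ((- (x - m) / s ^+ 2) * expR (e x)).
  have := is_derive1_comp (is_derive_expR (e x)) de.
  by rewrite mulrC.
have -> : (fun y : R => normal_peak s * normal_fun m s y) =
    normal_peak s \*: (expR \o e).
  by [].
apply: is_derive_eq; rewrite /GRing.scale/= /normal_fun /e; ring.
Qed.

(** With [y = t^2 / (2 s^2)], the bound [1 + y <= expR y] gives [expR (- y) <= 1 / y]. Decay in
    [t^-2] is enough to beat a factor linear in [t]. *)
Lemma normal_pdf_tail (t : R) : s != 0 -> t != 0 ->
  normal_pdf m s (m + t) <= normal_peak s * (s ^+ 2 *+ 2) / t ^+ 2.
Proof.
move=> s0 t0; rewrite normal_pdfE// /normal_fun -mulrA.
rewrite ler_wpM2l ?normal_peak_ge0//.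
rewrite addrAC subrr add0r mulNr.
have y0 : 0 < t ^+ 2 / (s ^+ 2 *+ 2).
  by rewrite divr_gt0// ?pmulrn_lgt0 ?exprn_even_gt0.
rewrite expRN -[leRHS]invrK invf_div lef_pV2 ?posrE ?expR_gt0//.
by apply: le_trans (expR_ge1Dx _); rewrite lerDr.
Qed.

Lemma measurable_sqr_affine (a b : R) :
  measurable_fun [set: R] (fun x : R => (a * x + b) ^+ 2).
Proof.
apply: measurable_funX; apply: measurable_funD => //; exact: measurable_funM.
Qed.

(* With [k = a m + b] and [K] the claimed value, [((a x + b)^2 - K) pdf(x)] is the
   derivative of [- s^2 (a^2 (x - m) + 2 a k) pdf(x)], which vanishes at
   infinity. *)
Lemma integral_normal_prob_sqr_affine (a b : R) : s != 0 ->
  (\int[normal_prob m s]_x ((a * x + b) ^+ 2)%:E =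
   (a ^+ 2 * s ^+ 2 + (a * m + b) ^+ 2)%:E)%E.
Proof.
move=> s0; set k := a * m + b; set K := _ + k ^+ 2.
pose g (x : R) : R := (a * x + b) ^+ 2.
pose h (x : R) : R := g x - K.
pose G (x : R) : R :=
  - (s ^+ 2 * (a ^+ 2 * (x - m) + a * k *+ 2)) * normal_pdf m s x.
pose E (n : nat) : set (measurableTypeR R) :=
  `[m - n.+1%:R, m + n.+1%:R]%classic.
have mE n : measurable (E n) by exact: measurable_itv.
have dh (x : R) : derivable h x 1 by [].
have ch : continuous h.
  by move=> x; apply: differentiable_continuous; apply/derivable1_diffP.
have dG (x : R) : is_derive x 1 G (h x * normal_pdf m s x).
  have := is_derive_normal_pdf x s0 => dp.
  rewrite /G; apply: is_derive_eq; rewrite /GRing.scale/=.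
  by rewrite /h /g /K /k; field.
have cG : continuous G.
  move=> x; apply: differentiable_continuous; apply/derivable1_diffP.
  exact: ex_derive.
have hE n : (\int[mu]_(x in E n) (h x * normal_pdf m s x)%:E =
    (G (m + n.+1%:R) - G (m - n.+1%:R))%:E)%E.
  rewrite EFinB; apply: continuous_FTC2.
  - by rewrite ltrD2l gtrN ?ltr0Sn.
  - apply: continuous_subspaceT => x; apply: cvgM; first exact: ch.
    exact: continuous_normal_pdf.
  - split; first by move=> x _; exact: ex_derive.
      by apply: cvg_at_right_filter; exact: cG.
    by apply: cvg_at_left_filter; exact: cG.
  - by move=> x _; rewrite derive1E; apply: derive_val.
(* A continuous function is bounded on the compact [E n]; this integrability is what the passage to
   the density requires. *)
have inth n : (normal_prob m s).-integrable (E n) (EFin \o h).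
  apply: measurable_bounded_integrable => //.
  - apply: (@le_lt_trans _ _ 1%E); last exact: ltry.
    exact: probability_le1.
  - by apply: measurable_funTS; exact: continuous_measurable_fun.
  - have /compact_bounded[M [Mr MP]] : compact (h @` E n).
      apply: continuous_compact; first exact: continuous_subspaceT.
      exact: segment_compact.
    by exists M; split => // y /MP yP x Ex; apply: yP; exists x.
have gE n : (\int[normal_prob m s]_(x in E n) (g x)%:E =
    K%:E * normal_prob m s (E n) + (G (m + n.+1%:R) - G (m - n.+1%:R))%:E)%E.
  under eq_integral do rewrite -[g _](subrK K) EFinD.
  rewrite integralD//; last first.
    by apply: finite_measure_integrable_cst.
  rewrite integral_cst// addeC; congr (_ + _)%E.
  by rewrite (integral_normal_prob _ _ (mE n) (inth n)) -hE.
have cvgG : (G (m + n.+1%:R) - G (m - n.+1%:R)) @[n --> \oo] --> (0 : R).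
  (* At distance [|t| >= 1] from [m], the affine factor of [G] is at most [(a^2 + 2 |a k|) |t|];
     times the tail bound in [t^-2] this leaves [c / |t|], and [|t| = n + 1] makes it
     [c * harmonic n]. *)
  pose c := s ^+ 2 * (a ^+ 2 + `|a * k| *+ 2) * (normal_peak s * (s ^+ 2 *+ 2)).
  have Gc n (t : R) : `|t| = n.+1%:R -> `|G (m + t)| <= c * harmonic n.
    move=> tn.
    have t1 : 1 <= `|t| by rewrite tn ler1n.
    have t0 : t != 0 by rewrite -normr_gt0 (lt_le_trans _ t1).
    have -> : harmonic n = `|t|^-1 :> R by rewrite tn.
    rewrite /G /c normrM normrN normrM.
    rewrite [`|normal_pdf _ _ _|]ger0_norm ?normal_pdf_ge0//.
    rewrite (ger0_norm (sqr_ge0 s)).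
    apply: (@le_trans _ _ (s ^+ 2 * ((a ^+ 2 + `|a * k| *+ 2) * `|t|) *
        (normal_peak s * (s ^+ 2 *+ 2) / t ^+ 2))).
      apply: ler_pM; [|exact: normal_pdf_ge0| |exact: normal_pdf_tail].
        by apply: mulr_ge0 => //; exact: sqr_ge0.
      rewrite ler_wpM2l ?sqr_ge0// addrAC subrr add0r.
      rewrite (le_trans (ler_normD _ _))//.
      rewrite mulrDl normrM (ger0_norm (sqr_ge0 a)) lerD2l normrMn.
      by rewrite ler_peMr.
    rewrite -(real_normK (num_real t)) le_eqVlt; apply/orP; left; apply/eqP.
    by field; rewrite normr_eq0.
  apply: (@squeeze_cvgr _ _ _ _ (fun n => - (c *+ 2 * harmonic n))
    (fun n => c *+ 2 * harmonic n)).
  - apply: nearW => n; rewrite -ler_norml (le_trans (ler_normB _ _))//.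
    rewrite mulrnAl mulr2n lerD// Gc// ?normrN ger0_norm//.
  - rewrite -oppr0 -(mulr0 (c *+ 2)); apply: cvgN; apply: cvgMl_tmp.
    exact: cvg_harmonic.
  - by rewrite -(mulr0 (c *+ 2)); apply: cvgMl_tmp; exact: cvg_harmonic.
have UE : \bigcup_n E n = setT.
  apply/seteqP; split => // x _; exists (Num.trunc `|x - m|) => //.
  rewrite /E/= in_itv/= -ler_distlC distrC; apply: ltW; exact: truncnS_gt.
have ndE : nondecreasing_seq E.
  move=> p q pq; apply/subsetPset => x; rewrite /E /= !in_itv/= => /andP[].
  have : p.+1%:R <= q.+1%:R :> R by rewrite ler_nat.
  by move=> *; apply/andP; split; lra.
have cvgP : normal_prob m s (E n) @[n --> \oo] --> 1%E.
  rewrite -(@probability_setT _ _ _ (normal_prob m s)) -UE.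
  by apply: nondecreasing_cvg_mu => //; rewrite UE.
(* Monotone convergence along the intervals [E n]; the limit is then identified through [gE], where
   the mass of [E n] tends to 1 and the boundary terms to 0. *)
have cvgg : (\int[normal_prob m s]_(x in E n) (g x)%:E)%E @[n --> \oo] -->
   (\int[normal_prob m s]_x (g x)%:E)%E.
  rewrite -UE; apply: ge0_nondecreasing_set_cvg_integral => //.
  - move=> i; apply/measurable_EFinP; apply: measurable_funTS.
    exact: measurable_sqr_affine.
  - by move=> i x _; rewrite lee_fin sqr_ge0.
have cvgK : (\int[normal_prob m s]_(x in E n) (g x)%:E)%E @[n --> \oo] --> K%:E.
  rewrite (funext gE) -[X in _ --> X]adde0 -[X in _ --> (X + _)%E]mule1.
  apply: cvgeD => //; first exact: cvgeZl.
  by apply: cvg_EFin => //; exact: nearW.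
exact: cvg_unique cvgg cvgK.
Qed.

End normal_second_moment.

(** * Integrals against [gauss], zero variance included *)

Section gauss.
Context {R : realType}.
Implicit Types c v : R.

(* [normal_prob] is a measure on [measurableTypeR R], whereas integrals against
   [gauss] are taken on [R] itself: the two measurable structures have the same
   measurable sets but distinct displays, so [normal_prob] is transported along
   the identity. *)
Let idTR : measurableTypeR R -> R := idfun.
#[local] HB.instance Definition _ :=
  @isMeasurableFun.Build _ _ _ _ idTR (@measurable_id _ _ setT).

Lemma gauss_normalE c v : v != 0 ->
  gauss c v = distribution (normal_prob c (Num.sqrt v)) idTR.
Proof. by move=> v0; rewrite /gauss (negbTE v0). Qed.

(** [gauss] is a bare set function; rewriting it as some probability [P] opens the way to the lemmas
    on measures. *)
Lemma gauss_probability c v : exists P : probability R R, gauss c v = P.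
Proof.
have [->|v0] := eqVneq v 0; first by exists \d_c; rewrite /gauss eqxx.
rewrite gauss_normalE//.
by exists (distribution (normal_prob c (Num.sqrt v)) idTR).
Qed.

Lemma integral_gauss_ge0 c v (f : R -> \bar R) : (forall x, 0 <= f x)%E ->
  (0 <= \int[gauss c v]_x f x)%E.
Proof. by have [P ->] := gauss_probability c v => f0; exact: integral_ge0. Qed.

Lemma integral_gauss_pZl c v (k : R) (f : R -> \bar R) : 0 < k ->
  (forall x, 0 <= f x)%E ->
  (\int[gauss c v]_x (k%:E * f x) = k%:E * \int[gauss c v]_x f x)%E.
Proof.
by have [P ->] := gauss_probability c v => k0 f0; exact: ge0_integral_pZl.
Qed.

(** The constant [e] makes room for the variance term that the integral in [z] leaves inside the
    integral in [u]. The case [v = 0] is evaluation at [c]. *)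
Lemma integral_gauss_sqr_affine c v (a b e : R) : 0 <= v -> 0 <= e ->
  (\int[gauss c v]_x ((a * x + b) ^+ 2 + e)%:E =
   (a ^+ 2 * v + (a * c + b) ^+ 2 + e)%:E)%E.
Proof.
move=> v0 e0; have mf := measurable_sqr_affine a b.
have mfE : measurable_fun setT (fun x : R => ((a * x + b) ^+ 2)%:E).
  exact/measurable_EFinP.
transitivity (\int[gauss c v]_x ((a * x + b) ^+ 2)%:E + e%:E)%E.
  have [P ->] := gauss_probability c v.
  under eq_integral do rewrite EFinD.
  rewrite ge0_integralD//=; last by move=> x _; rewrite lee_fin sqr_ge0.
  by rewrite integral_cst//= probability_setT mule1.
rewrite EFinD; congr (_ + _)%E; have [->|vn0] := eqVneq v 0.
  by rewrite /gauss eqxx integral_dirac//= diracT mul1e mulr0 add0r.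
rewrite gauss_normalE// ge0_integral_pushforward//=; last first.
  by move=> x _; rewrite lee_fin sqr_ge0.
rewrite integral_normal_prob_sqr_affine ?sqr_sqrtr//.
by rewrite sqrtr_eq0 -ltNge lt_neqAle eq_sym vn0.
Qed.

(** * Positivity and scaling of the model expectations *)

Context {d : measure_display} {T : measurableType d}.
Variables (PX : probability T R) (m : T -> R) (A s2 : R).

Lemma E3_ge0 (f : T -> R -> R -> \bar R) : (forall x u z, 0 <= f x u z)%E ->
  (0 <= E3 PX m A s2 f)%E.
Proof.
move=> f0; apply: integral_ge0 => x _.
by apply: integral_gauss_ge0 => u; exact: integral_gauss_ge0.
Qed.

Lemma E3_pZl (k : R) (f : T -> R -> R -> \bar R) : 0 < k ->
  (forall x u z, 0 <= f x u z)%E ->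
  (E3 PX m A s2 (fun x u z => k%:E * f x u z) = k%:E * E3 PX m A s2 f)%E.
Proof.
move=> k0 f0; rewrite /E3 -ge0_integral_pZl//; last first.
  by move=> x; apply: integral_gauss_ge0 => u; exact: integral_gauss_ge0.
apply: eq_integral => x _; rewrite -integral_gauss_pZl//; last first.
  by move=> u; exact: integral_gauss_ge0.
by congr integral; apply/funext => u; exact: integral_gauss_pZl.
Qed.

Lemma Edata_ge0 n (F : n.-tuple (T * R) -> \bar R) : (forall D, 0 <= F D)%E ->
  (0 <= Edata PX m A s2 F)%E.
Proof.
elim: n F => [|n IH] F F0 //=.
by apply: E3_ge0 => x _ z; exact: IH.
Qed.

(** Induction on the sample size: each draw adds one [E3], and the inner expectation only has to be
    nonnegative. *)
Lemma Edata_pZl n (k : R) (F : n.-tuple (T * R) -> \bar R) : 0 < k ->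
  (forall D, 0 <= F D)%E ->
  (Edata PX m A s2 (fun D => k%:E * F D) = k%:E * Edata PX m A s2 F)%E.
Proof.
move=> k0; elim: n F => [|n IH] F F0 //=.
pose G x (_ : R) z := Edata PX m A s2 (fun D => F (cons_tuple (x, z) D)).
have G0 x u z : (0 <= G x u z)%E by apply: Edata_ge0 => D; exact: F0.
rewrite -[RHS](E3_pZl _ G k0 G0).
congr E3; apply/funext => x; apply/funext => u; apply/funext => z.
by apply: IH => D; exact: F0.
Qed.

(** * Exact excess loss of the plug-in denoiser *)

Hypotheses (A0 : 0 <= A) (s20 : 0 < s2) (mm : measurable_fun setT m).

Lemma E3_plugin (h : T -> R) : measurable_fun setT h ->
  (E3 PX m A s2 (fun x u z =>
     ((A / (s2 + A) * z + s2 / (s2 + A) * h x - u) ^+ 2)%:E) =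
   (A * s2 / (s2 + A))%:E +
   (s2 ^+ 2 / (s2 + A) ^+ 2)%:E * \int[PX]_x ((h x - m x) ^+ 2)%:E)%E.
Proof.
move=> mh; have sA : s2 + A != 0 by rewrite gt_eqF// ltr_wpDr.
set a := A / (s2 + A); set b := s2 / (s2 + A).
have zE (x : T) (u : R) :
    (\int[gauss u s2]_z ((a * z + b * h x - u) ^+ 2)%:E =
     ((- b * u + b * h x) ^+ 2 + a ^+ 2 * s2)%:E)%E.
  transitivity (\int[gauss u s2]_z ((a * z + (b * h x - u)) ^+ 2 + 0)%:E)%E.
    by congr integral; apply/funext => z; rewrite addr0 addrA.
  (* The mean of [a z + b h - u] is [- b u + b h], because [a - 1 = - b]. *)
  rewrite (integral_gauss_sqr_affine _ _ _ _ _ (ltW s20) (lexx 0)).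
  by congr EFin; rewrite /a /b; field.
have uE (x : T) :
    (\int[gauss (m x) A]_u ((- b * u + b * h x) ^+ 2 + a ^+ 2 * s2)%:E =
     (A * s2 / (s2 + A))%:E +
     (s2 ^+ 2 / (s2 + A) ^+ 2)%:E * ((h x - m x) ^+ 2)%:E)%E.
  rewrite integral_gauss_sqr_affine//; last by rewrite mulr_ge0 ?sqr_ge0 ?ltW.
  (* The two variance terms combine: [b^2 A + a^2 s2 = A s2 / (s2 + A)]. *)
  by rewrite -EFinM -EFinD; congr EFin; rewrite /a /b; field.
transitivity (\int[PX]_x ((A * s2 / (s2 + A))%:E +
     (s2 ^+ 2 / (s2 + A) ^+ 2)%:E * ((h x - m x) ^+ 2)%:E))%E.
  apply: eq_integral => x _; rewrite -uE.
  by congr integral; apply/funext => u; exact: zE.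
have mhm : measurable_fun setT (fun x => ((h x - m x) ^+ 2)%:E).
  by apply/measurable_EFinP/measurable_funX/measurable_funB.
have c0 : 0 <= s2 ^+ 2 / (s2 + A) ^+ 2 by rewrite divr_ge0 ?sqr_ge0.
rewrite ge0_integralD//=.
- rewrite integral_cst//= probability_setT mule1; congr (_ + _)%E.
  by rewrite ge0_integralZl//= => x _; rewrite lee_fin sqr_ge0.
- by move=> x _; rewrite lee_fin divr_ge0// ?mulr_ge0// ?addr_ge0// ltW.
- by move=> x _; rewrite mule_ge0// lee_fin// sqr_ge0.
- exact: measurable_funeM.
Qed.

(** The Bayes rule is itself the plug-in rule at [h = m], so [E3_plugin] evaluates both risks; the
    common term is finite and cancels. *)
Lemma EB_loss_plugin (h : T -> R) : measurable_fun setT h ->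
  (EB_loss PX m A s2 (fun x z => A / (s2 + A) * z + s2 / (s2 + A) * h x)%R =
   (s2 ^+ 2 / (s2 + A) ^+ 2)%:E * \int[PX]_x ((h x - m x) ^+ 2)%:E)%E.
Proof.
move=> mh; rewrite /EB_loss /bayes_rule !E3_plugin//.
under [X in (_ - (_ + _ * X))%E]eq_integral do rewrite subrr expr0n.
by rewrite integral0 mule0 adde0 addeAC subee ?add0e.
Qed.

End gauss.

(** * From the plug-in identity to the minimax bound *)

Theorem theorem1 (R : realType) (d : measure_display) (T : measurableType d)
  (PX : probability T R) (C : set (T -> R)) (A sigma : R) (n : nat) :
  0 <= A -> 0 < sigma ->
  (forall m, C m -> measurable_fun setT m) ->
  (minimax_EB PX C A (sigma ^+ 2) n
   <= (sigma ^+ 4 / (sigma ^+ 2 + A) ^+ 2)%:E * minimax_Reg PX C A (sigma ^+ 2) n)%E.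
Proof.
move=> A0 sigma0 mC; set s2 := sigma ^+ 2.
have s20 : 0 < s2 by rewrite exprn_gt0.
have sA : 0 < s2 + A by rewrite ltr_wpDr.
have -> : sigma ^+ 4 = s2 ^+ 2 by rewrite -exprM.
have k0 : 0 < s2 ^+ 2 / (s2 + A) ^+ 2 by rewrite divr_gt0// exprn_gt0.
(* The positive factor moves inside the infimum, which leaves one bound to prove per regression
   estimator [mh]. *)
rewrite /minimax_Reg -ereal_inf_pZl//.
apply: le_ereal_inf_tmp => _ [_ [mh /= mmh <-] <-].
apply: ge_ereal_inf.
exists (ereal_sup [set Edata PX m A s2 (fun D => EB_loss PX m A s2
    (fun x z => A / (s2 + A) * z + s2 / (s2 + A) * mh D x)) | m in C]).
  exists (fun D x z => A / (s2 + A) * z + s2 / (s2 + A) * mh D x) => //=.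
  apply: measurable_funD; apply: measurable_funM => //.
    exact: measurableT_comp measurable_snd measurable_snd.
  apply: (measurableT_comp mmh (g := fun p => (p.1, p.2.1))).
  apply: measurable_fun_pair => //.
  exact: measurableT_comp measurable_fst measurable_snd.
(* Inside the supremum the comparison is made for each [m] separately, and there it is an
   equality. *)
rewrite -ereal_sup_pZl//; apply: ereal_sup_le => _ [m Cm <-].
eexists; first by exists m.
rewrite -Edata_pZl//; last first.
  by move=> D; apply: integral_ge0 => x _; rewrite lee_fin sqr_ge0.
congr Edata; apply/funext => D; rewrite EB_loss_plugin//; first exact: mC.
exact: (measurable_fun_pair2 D mmh).
Qed.
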